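(* Let $E=\{1,\dots,n\}$ be a set of objects described by $p$ histogram variables, partitioned into nonempty clusters $P=(C_1,\dots,C_K)$ with prototypes $\mathbf{g}_k=(g_{k1},\dots,g_{kp})$, where $g_{kj}$ is the barycenter of $\{y_{ij}:i\in C_k\}$. For the adaptive squared Wasserstein distances GC-AWD and CDC-AWD, the total sum of squares decomposes into the within and between sums of squares: $$TSS_{GC-AWD}=WSS_{GC-AWD}+BSS_{GC-AWD},\qquad TSS_{CDC-AWD}=WSS_{CDC-AWD}+BSS_{CDC-AWD}.$$
   Context: A histogram is a probability distribution on a bounded real interval $S$ (its support), given by a partition of $S$ into finitely many contiguous intervals (bins) with nonnegative weights summing to $1$, the mass being spread uniformly within each bin. Its quantile function is $F^{-1}(t)=\inf\{y\in S:F(y)\ge t\}$, $t\in[0,1]$, with $F$ its distribution function. Object $i$ is described by $\mathbf{y}_i=[y_{i1},\dots,y_{ip}]$, each $y_{ij}$ a histogram with quantile function $F_i^{-1}(t_j)$ (the subscript $j$ on the argument indicates the variable), mean $\bar y_{ij}=\int_0^1F_i^{-1}(t_j)dt_j$ and centered description $y_{ij}^c$ with quantile function $F_i^{-1c}(t_j)=F_i^{-1}(t_j)-\bar y_{ij}$. The squared Wasserstein distance between distributions with quantile functions $F^{-1},H^{-1}$ is $d_W^2=\int_0^1(F^{-1}(t)-H^{-1}(t))^2dt$. Let $n_k=|C_k|$. The barycenter $g_{kj}$ is the histogram with quantile function $\frac1{n_k}\sum_{i\in C_k}F_i^{-1}(t_j)$; $\bar y_{g_{kj}}$ is its mean and $g^c_{kj}$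 its centered description. Weights: - GC-AWD: $\lambda^j_{\bar y},\lambda^j_{Disp}>0$ with $\prod_j\lambda^j_{\bar y}=\prod_j\lambda^j_{Disp}=1$. - CDC-AWD: $\lambda^j_{k,\bar y},\lambda^j_{k,Disp}>0$ with $\prod_j\lambda^j_{k,\bar y}=\prod_j\lambda^j_{k,Disp}=1$ for each $k$. The general prototype $\mathbf{g}_E=(g_{E1},\dots,g_{Ep})$ is a vector of histograms; $g_{Ej}$ has mean $\bar y_{g_{Ej}}$ and its centered description $g^c_{Ej}$ has quantile function $F^{-1c}_{g_E}(t_j)$, where: - GC-AWD: $\bar y_{g_{Ej}}=\frac1n\sum_{i=1}^n\bar y_{ij}$ and $F^{-1c}_{g_E}(t_j)=\frac1n\sum_{i=1}^nF_i^{-1c}(t_j)$. - CDC-AWD: $\bar y_{g_{Ej}}=\sum_{k=1}^K\frac{\lambda^j_{k,\bar y}}{\sum_{h=1}^Kn_h\lambda^j_{h,\bar y}}\sum_{i\in C_k}\bar y_{ij}$ and $F^{-1c}_{g_E}(t_j)=\sum_{k=1}^K\frac{\lambda^j_{k,Disp}}{\sum_{h=1}^Kn_h\lambda^j_{h,Disp}}\sum_{i\in C_k}F_i^{-1c}(t_j)$. Sums of squares for GC-AWD: $TSS_{GC-AWD}=\sum_{j=1}^p\sum_{i\in E}[\lambda^j_{\bar y}(\bar y_{ij}-\bar y_{g_{Ej}})^2+\lambda^j_{Disp}d_W^2(y^c_{ij},g^c_{Ej})]$, $WSS_{GC-AWD}=\sum_{k=1}^K\sum_{i\in C_k}\sum_{j=1}^p[\lambda^j_{\bar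 y}(\bar y_{ij}-\bar y_{g_{kj}})^2+\lambda^j_{Disp}d_W^2(y^c_{ij},g^c_{kj})]$, $BSS_{GC-AWD}=\sum_{j=1}^p\sum_{k=1}^Kn_k[\lambda^j_{\bar y}(\bar y_{g_{kj}}-\bar y_{g_{Ej}})^2+\lambda^j_{Disp}d_W^2(g^c_{kj},g^c_{Ej})]$. Sums of squares for CDC-AWD: $TSS_{CDC-AWD}=\sum_{j=1}^p\sum_{k=1}^K\sum_{i\in C_k}[\lambda^j_{k,\bar y}(\bar y_{ij}-\bar y_{g_{Ej}})^2+\lambda^j_{k,Disp}d_W^2(y^c_{ij},g^c_{Ej})]$, $WSS_{CDC-AWD}=\sum_{k=1}^K\sum_{i\in C_k}\sum_{j=1}^p[\lambda^j_{k,\bar y}(\bar y_{ij}-\bar y_{g_{kj}})^2+\lambda^j_{k,Disp}d_W^2(y^c_{ij},g^c_{kj})]$, $BSS_{CDC-AWD}=\sum_{j=1}^p\sum_{k=1}^Kn_k[\lambda^j_{k,\bar y}(\bar y_{g_{kj}}-\bar y_{g_{Ej}})^2+\lambda^j_{k,Disp}d_W^2(g^c_{kj},g^c_{Ej})]$. *)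

(* Defs.v *)
From HB Require Import structures.
From mathcomp Require Import all_boot all_order all_algebra.
From mathcomp Require Import all_classical all_reals all_analysis.
Import Order.TTheory GRing.Theory Num.Theory.
Import numFieldNormedType.Exports.

Set Implicit Arguments.
Unset Strict Implicit.
Unset Printing Implicit Defensive.

Local Open Scope classical_set_scope.
Local Open Scope ring_scope.

(* [hist_break] lists the end points b_0 < ... < b_m of the m contiguous bins;
   bin l is [b_l, b_{l+1}].  A bin of weight 0 is allowed, an empty or
   one-point bin is not.  The weights summing to 1 forces m > 0. *)
Record histogram (R : realType) := Histogram {
  hist_bins : nat;
  hist_break : 'I_hist_bins.+1 -> R;
  hist_weight : 'I_hist_bins -> R;
  hist_break_lt : forall l : 'I_hist_bins,
    hist_break (widen_ord (leqnSn _) l) < hist_break (lift ord0 l);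
  hist_weight_ge0 : forall l, 0 <= hist_weight l;
  hist_weight_sum : \sum_l hist_weight l = 1 }.
Arguments hist_break {R} h _.
Arguments hist_weight {R} h _.

Section Histogram.
Context (R : realType) (h : histogram R).

(* The mass of each bin is spread uniformly in it. *)
Definition hist_prob (A : set (measurableTypeR R)) : \bar R :=
  (\sum_(l < hist_bins h)
     (hist_weight h l)%:E * uniform_prob (hist_break_lt l) A)%E.

Let hist_prob0 : hist_prob set0 = 0%E.
Proof. by rewrite /hist_prob big1// => l _; rewrite measure0 mule0. Qed.

Let hist_prob_ge0 A : (0 <= hist_prob A)%E.
Proof.
apply: sume_ge0 => l _; apply: mule_ge0 => //.
by rewrite lee_fin hist_weight_ge0.
Qed.

Let hist_prob_sigma_additive : semi_sigma_additive hist_prob.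
Proof.
move=> F mF tF mUF; apply: cvg_toP.
  by apply: is_cvg_nneseries => k _ _; exact: hist_prob_ge0.
rewrite /hist_prob nneseries_sum; last first.
  by move=> l k _; rewrite mule_ge0// lee_fin hist_weight_ge0.
apply: eq_bigr => l _; rewrite nneseriesZl//.
congr (_ * _)%E; apply/cvg_lim => //.
exact: measure_semi_sigma_additive.
Qed.

HB.instance Definition _ := isMeasure.Build _ _ _ hist_prob
  hist_prob0 hist_prob_ge0 hist_prob_sigma_additive.

Let hist_prob_setT : hist_prob setT = 1%E.
Proof.
rewrite /hist_prob -[RHS]/(1%R%:E) -(hist_weight_sum h) -sumEFin.
by apply: eq_bigr => l _; rewrite probability_setT mule1.
Qed.

HB.instance Definition _ :=
  @Measure_isProbability.Build _ _ R hist_prob hist_prob_setT.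

Definition hist_support : set R :=
  `[hist_break h ord0, hist_break h ord_max].

Definition hist_cdf (x : R) : R := fine (hist_prob `]-oo, x]).

Definition quantile (t : R) : R :=
  inf [set x | hist_support x /\ t <= hist_cdf x].

Definition hist_mean : R := \int[lebesgue_measure]_(t in `[0, 1]) quantile t.

(* quantile function of the centered description *)
Definition cquantile (t : R) : R := quantile t - hist_mean.

End Histogram.

(* squared Wasserstein distance between the distributions with quantile
   functions [F] and [H] *)
Definition dW2 (R : realType) (F H : R -> R) : R :=
  \int[lebesgue_measure]_(t in `[0, 1]) (F t - H t) ^+ 2.

(* (C_1, ..., C_K) is a partition of {1, ..., n} into nonempty clusters; as
   [partition] speaks about the set of clusters, injectivity is needed to
   exclude repetitions in the family. *)
Definition clustering (n K : nat) (C : 'I_K -> {set 'I_n}) : Prop :=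
  injective C /\ finset.partition [set C k | k : 'I_K]%SET [set: 'I_n]%SET.

Definition is_barycenter (R : realType) (n : nat) (A : {set 'I_n})
    (y : 'I_n -> histogram R) (g : histogram R) : Prop :=
  forall t : R, t \in `[0, 1] ->
    quantile g t = (#|A|%:R)^-1 * \sum_(i in A) quantile (y i) t.

Definition product_one_weights (R : realType) (p : nat) (lam : 'I_p -> R) :
    Prop :=
  (forall j, 0 < lam j) /\ \prod_j lam j = 1.

Section GC_AWD.
Context (R : realType) (n p K : nat).
Variables (y : 'I_n -> 'I_p -> histogram R) (C : 'I_K -> {set 'I_n}).
Variables (g : 'I_K -> 'I_p -> histogram R) (lmean ldisp : 'I_p -> R).
Variable gE : 'I_p -> histogram R.

Definition GC_prototype : Prop :=
  forall j,
    hist_mean (gE j) = n%:R^-1 * \sum_i hist_mean (y i j) /\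
    forall t : R, t \in `[0, 1] ->
      cquantile (gE j) t = n%:R^-1 * \sum_i cquantile (y i j) t.

Definition TSS_GC : R :=
  \sum_j \sum_i
    (lmean j * (hist_mean (y i j) - hist_mean (gE j)) ^+ 2 +
     ldisp j * dW2 (cquantile (y i j)) (cquantile (gE j))).

Definition WSS_GC : R :=
  \sum_k \sum_(i in C k) \sum_j
    (lmean j * (hist_mean (y i j) - hist_mean (g k j)) ^+ 2 +
     ldisp j * dW2 (cquantile (y i j)) (cquantile (g k j))).

Definition BSS_GC : R :=
  \sum_j \sum_k #|C k|%:R *
    (lmean j * (hist_mean (g k j) - hist_mean (gE j)) ^+ 2 +
     ldisp j * dW2 (cquantile (g k j)) (cquantile (gE j))).

End GC_AWD.

Section CDC_AWD.
Context (R : realType) (n p K : nat).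
Variables (y : 'I_n -> 'I_p -> histogram R) (C : 'I_K -> {set 'I_n}).
Variables (g : 'I_K -> 'I_p -> histogram R) (lmean ldisp : 'I_K -> 'I_p -> R).
Variable gE : 'I_p -> histogram R.

Definition CDC_prototype : Prop :=
  forall j,
    hist_mean (gE j) =
      \sum_k lmean k j / (\sum_h #|C h|%:R * lmean h j) *
        \sum_(i in C k) hist_mean (y i j) /\
    forall t : R, t \in `[0, 1] ->
      cquantile (gE j) t =
        \sum_k ldisp k j / (\sum_h #|C h|%:R * ldisp h j) *
          \sum_(i in C k) cquantile (y i j) t.

Definition TSS_CDC : R :=
  \sum_j \sum_k \sum_(i in C k)
    (lmean k j * (hist_mean (y i j) - hist_mean (gE j)) ^+ 2 +
     ldisp k j * dW2 (cquantile (y i j)) (cquantile (gE j))).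

Definition WSS_CDC : R :=
  \sum_k \sum_(i in C k) \sum_j
    (lmean k j * (hist_mean (y i j) - hist_mean (g k j)) ^+ 2 +
     ldisp k j * dW2 (cquantile (y i j)) (cquantile (g k j))).

Definition BSS_CDC : R :=
  \sum_j \sum_k #|C k|%:R *
    (lmean k j * (hist_mean (g k j) - hist_mean (gE j)) ^+ 2 +
     ldisp k j * dW2 (cquantile (g k j)) (cquantile (gE j))).

End CDC_AWD.

(* Main.v *)
Require Import Defs.
From HB Require Import structures.
From mathcomp Require Import all_boot all_order all_algebra.
From mathcomp Require Import all_classical all_reals all_analysis.
From mathcomp Require Import measurable_realfun ring lra.
Import Order.TTheory GRing.Theory Num.Theory.

Local Open Scope ring_scope.

(** Both identities are instances of Huygens' theorem, applied inside each
    cluster and for each variable separately.  If [c] is the average of real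
    numbers [x_i], then for every [e] the cross term of
    [(x_i - e)^2 = ((x_i - c) + (c - e))^2] sums to zero, whence
    [sum_i (x_i - e)^2 = sum_i (x_i - c)^2 + m (c - e)^2], with [m] the number
    of terms ([sum_sqr_dev]).  The means of the cluster satisfy this with [c]
    the mean of the barycenter; the centered quantile functions satisfy it at
    each [t] of [[0, 1]], and integrating over [t] gives the same identity for
    the squared Wasserstein distances ([sum_dW2_dev]).  In both cases the weight
    is constant on the cluster, so it factors out ([sum_adaptive_dev]), and
    taking for [e] the general prototype gives the total dispersion on the left,
    the within and the between dispersions on the right.

    The analytic input is that everything in sight is integrable on [[0, 1]]:
    a quantile function takes its values in the support, or is the infimum [0]
    of the empty set, so it is bounded; and it is nondecreasing where the set
    under the infimum is inhabited, which happens on an interval, so it is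
    measurable ([quantile_bounded_measurable]).

    The weights of GC-AWD are those of CDC-AWD taken independent of the
    cluster, and the clusters partition the objects, so the first identity is a
    case of the second. *)

(** * Bounded measurable functions on the unit interval *)

Section BoundedMeasurable.
Context {R : realType}.
Local Notation mu := (@lebesgue_measure R).
Local Notation I01 := (`[0, 1]%classic : set R).
Implicit Types f g : R -> R.

(** Contrary to integrability, this condition is stable under products. *)
Definition bounded_measurable f : Prop :=
  measurable_fun I01 f /\ exists M, forall t, I01 t -> `|f t| <= M.

Lemma bounded_measurable_integrable f :
  bounded_measurable f -> mu.-integrable I01 (EFin \o f).
Proof.
move=> [mf [M fM]]; apply: measurable_bounded_integrable => //.
  by rewrite /= lebesgue_measure_itv/= lte_fin ltr01 -EFinB ltry.
exists M; split; first exact: num_real.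
by move=> x Mx t It; exact: le_trans (fM t It) (ltW Mx).
Qed.

Lemma bounded_measurable_cst (r : R) : bounded_measurable (fun=> r).
Proof. by split; [exact: measurable_cst | exists `|r|]. Qed.

Lemma bounded_measurableB f g : bounded_measurable f -> bounded_measurable g ->
  bounded_measurable (fun t => f t - g t).
Proof.
move=> [mf [M fM]] [mg [N gN]]; split; first exact: measurable_funB.
exists (M + N) => t It; apply: le_trans (ler_normB _ _) _.
by rewrite lerD ?fM ?gN.
Qed.

Lemma bounded_measurable_sqr f : bounded_measurable f ->
  bounded_measurable (fun t => f t ^+ 2).
Proof.
move=> [mf [M fM]]; split; first exact: measurable_funX.
exists (M ^+ 2) => t It.
by rewrite normrX lerXn2r ?nnegrE ?(le_trans _ (fM t It)) ?fM.
Qed.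

Lemma Rintegral01_sum {J : Type} (s : seq J) (P : pred J) (F : J -> R -> R) :
  (forall i, bounded_measurable (F i)) ->
  \int[mu]_(t in I01) (\sum_(i <- s | P i) F i t) =
  \sum_(i <- s | P i) \int[mu]_(t in I01) F i t.
Proof.
move=> bmF; elim: s => [|i s IHs].
  under eq_Rintegral do rewrite big_nil.
  by rewrite big_nil Rintegral_cst// mul0r.
under eq_Rintegral do rewrite big_cons.
rewrite big_cons; case: (P i) => //; rewrite RintegralD//; first by rewrite IHs.
  exact: bounded_measurable_integrable.
rewrite (_ : _ \o _ = fun t => (\sum_(i <- s | P i) (F i t)%:E)%E).
  by apply: integrable_sum => // j _; exact: bounded_measurable_integrable.
by apply/funext => t /=; rewrite sumEFin.
Qed.

(** The infimum lies in [[a, b]] or is that of the empty set, hence the bound.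
    Raising the threshold [t] shrinks the set, so the infimum is nondecreasing
    in [t] as long as the set is inhabited, that is on a down-closed set of
    thresholds. *)
Lemma threshold_inf_bounded_measurable (a b : R) (G : R -> R) :
  bounded_measurable (fun t => inf [set x | `[a, b]%classic x /\ t <= G x]).
Proof.
pose E t := [set x | `[a, b]%classic x /\ t <= G x]%classic.
pose S := [set t | E t !=set0]%classic.
have E_lb t : lbound (E t) a by move=> x [/=]; rewrite in_itv => /andP[].
have E_inf t : S t -> a <= inf (E t) <= b.
  move=> [x Ex]; rewrite lb_le_inf/=; [|by exists x|exact: E_lb].
  have /le_trans : inf (E t) <= x by apply: ge_inf => //; exists a; exact: E_lb.
  by apply; case: Ex => /=; rewrite in_itv => /andP[].
have SW s t : s <= t -> S t -> S s.
  by move=> st [x [abx tx]]; exists x; split => //; exact: le_trans tx.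
split; last first.
  exists (`|a| + `|b|) => t _.
  have [E0|/set0P St] := eqVneq (E t) set0%classic.
    by rewrite -/(E t) E0 inf0 normr0 addr_ge0.
  have /andP[ai ib] := E_inf _ St; rewrite -/(E t) ler_norml.
  have := ler_norm b; have := ler_normr (-a) a; have := normr_ge0 a.
  have := normr_ge0 b; have := ler_norm (- a); rewrite normrN; lra.
(* Outside of S the infimum is the default value 0, which breaks monotonicity;
   the value b restores it. *)
pose f t := if t \in S then inf (E t) else b.
have f_nd : {homo f : s t / s <= t}.
  move=> s t st; rewrite /f.
  have [/[!inE] St|nSt] := boolP (t \in S); last first.
    by case: ifPn => [/[!inE] /E_inf/andP[]|].
  have Ss := SW _ _ st St; rewrite mem_set//.
  apply: lb_le_inf => // x [abx tx].
  by apply: ge_inf; [exists a; exact: E_lb | split => //; exact: le_trans tx].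
have mS : measurable S.
  apply: is_interval_measurable => s t Ss St u /andP[_ ut]; exact: SW ut St.
have -> : (fun t => inf (E t)) = (fun t => if t \in S then f t else 0).
  apply/funext => t; rewrite /f; case: (boolP (t \in S)) => // /negP nSt.
  have [->|/set0P Et] := eqVneq (E t) set0%classic; first by rewrite inf0.
  by case: nSt; rewrite inE.
apply: (measurable_funS measurableT) => //.
apply: measurable_fun_ifT; last exact: measurable_cst.
  apply: (@measurable_fun_bool _ _ _ _ true) => //.
  rewrite setTI (_ : _ @^-1` _ = S)%classic//.
  by apply/seteqP; split => t; [exact: set_mem | exact: mem_set].
exact: nondecreasing_measurable.
Qed.

Lemma quantile_bounded_measurable (h : histogram R) :
  bounded_measurable (quantile h).
Proof. exact: threshold_inf_bounded_measurable. Qed.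

Lemma cquantile_bounded_measurable (h : histogram R) :
  bounded_measurable (cquantile h).
Proof.
exact: bounded_measurableB (quantile_bounded_measurable h)
  (bounded_measurable_cst _).
Qed.

End BoundedMeasurable.

(** * Huygens' theorem *)

Lemma sum_sqr_dev {R : realType} {J : finType} (A : {set J}) (x : J -> R)
    (c e : R) :
  #|A|%:R * c = \sum_(i in A) x i ->
  \sum_(i in A) (x i - e) ^+ 2 =
  \sum_(i in A) (x i - c) ^+ 2 + #|A|%:R * (c - e) ^+ 2.
Proof.
move=> Hc.
transitivity (\sum_(i in A)
    ((x i - c) ^+ 2 + (c - e) ^+ 2 + 2 * (c - e) * (x i - c))).
  by apply: eq_bigr => i _; ring.
have dev0 : \sum_(i in A) (x i - c) = 0.
  by rewrite sumrB -Hc sumr_const mulr_natl subrr.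
rewrite !big_split/= -[X in _ + X = _]mulr_sumr dev0 mulr0 addr0.
by rewrite sumr_const mulr_natl.
Qed.

Lemma sum_linear_combination {R : realType} {J : finType} (A : {set J})
    (a b m u v : R) (F G F' G' : J -> R) :
  \sum_(i in A) F i = \sum_(i in A) F' i + m * u ->
  \sum_(i in A) G i = \sum_(i in A) G' i + m * v ->
  \sum_(i in A) (a * F i + b * G i) =
  \sum_(i in A) (a * F' i + b * G' i) + m * (a * u + b * v).
Proof. by move=> FE GE; rewrite !big_split/= -!mulr_sumr FE GE; ring. Qed.

Section Barycenter.
Context {R : realType} {n : nat}.
Context {A : {set 'I_n}} {y : 'I_n -> histogram R} {g : histogram R}.
Hypothesis bg : is_barycenter A y g.
Local Notation mu := (@lebesgue_measure R).

Lemma card_mul_average (F : 'I_n -> R) :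
  #|A|%:R * ((#|A|%:R)^-1 * \sum_(i in A) F i) = \sum_(i in A) F i.
Proof.
(* When [A] is empty the inverse of its cardinal is the junk value 0, but the
   sum vanishes too. *)
have [->|[i Ai]] := set_0Vmem A; first by rewrite !big_set0 !mulr0.
by rewrite mulVKf// pnatr_eq0 -lt0n; apply/card_gt0P; exists i.
Qed.

Lemma sum_barycenter_quantile (t : R) : t \in `[0, 1] ->
  #|A|%:R * quantile g t = \sum_(i in A) quantile (y i) t.
Proof. by move=> /bg ->; exact: card_mul_average. Qed.

Lemma sum_barycenter_mean :
  #|A|%:R * hist_mean g = \sum_(i in A) hist_mean (y i).
Proof.
rewrite /hist_mean -Rintegral01_sum; last first.
  by move=> i; exact: quantile_bounded_measurable.
rewrite -RintegralZl//; last first.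
  exact/bounded_measurable_integrable/quantile_bounded_measurable.
by apply: eq_Rintegral => t; rewrite inE => It; exact: sum_barycenter_quantile.
Qed.

Lemma sum_barycenter_cquantile (t : R) : t \in `[0, 1] ->
  #|A|%:R * cquantile g t = \sum_(i in A) cquantile (y i) t.
Proof.
move=> It.
by rewrite mulrBr sum_barycenter_quantile// sum_barycenter_mean sumrB.
Qed.

(** Huygens' theorem holds for the values of the quantile functions at each
    [t]; the identity is its integral. *)
Lemma sum_dW2_dev (e : histogram R) :
  \sum_(i in A) dW2 (cquantile (y i)) (cquantile e) =
  \sum_(i in A) dW2 (cquantile (y i)) (cquantile g) +
  #|A|%:R * dW2 (cquantile g) (cquantile e).
Proof.
have bm (h k : histogram R) :
    bounded_measurable (fun t => (cquantile h t - cquantile k t) ^+ 2).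
  by apply/bounded_measurable_sqr/bounded_measurableB;
    exact: cquantile_bounded_measurable.
have sum_dW2 (k : histogram R) :
    \sum_(i in A) dW2 (cquantile (y i)) (cquantile k) = \int[mu]_(t in `[0, 1])
      \sum_(i in A) (cquantile (y i) t - cquantile k t) ^+ 2.
  by rewrite Rintegral01_sum.
have card_dW2 : #|A|%:R * dW2 (cquantile g) (cquantile e) =
    \int[mu]_(t in `[0, 1]) (#|A|%:R * (cquantile g t - cquantile e t) ^+ 2).
  by rewrite RintegralZl//; exact: bounded_measurable_integrable.
apply: etrans (sum_dW2 e) _.
apply: etrans _ (esym (congr2 +%R (sum_dW2 g) card_dW2)).
rewrite -RintegralD//.
- apply: eq_Rintegral => t; rewrite inE => It.
  exact/sum_sqr_dev/sum_barycenter_cquantile.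
- rewrite (_ : _ \o _ = fun t =>
      (\sum_(i in A) ((cquantile (y i) t - cquantile g t) ^+ 2)%:E)%E).
    by apply: integrable_sum => // i _; exact: bounded_measurable_integrable.
  by apply/funext => t /=; rewrite sumEFin.
- apply: (@integrableZl _ _ _ _ _ _ _ (EFin \o _)) => //.
  exact: bounded_measurable_integrable.
Qed.

(** On a cluster the weights are constants, so that Huygens' theorem for the
    means and for the dispersions combine linearly. *)
Lemma sum_adaptive_dev (a b : R) (e : histogram R) :
  \sum_(i in A) (a * (hist_mean (y i) - hist_mean e) ^+ 2 +
                 b * dW2 (cquantile (y i)) (cquantile e)) =
  \sum_(i in A) (a * (hist_mean (y i) - hist_mean g) ^+ 2 +
                 b * dW2 (cquantile (y i)) (cquantile g)) +
  #|A|%:R * (a * (hist_mean g - hist_mean e) ^+ 2 +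
             b * dW2 (cquantile g) (cquantile e)).
Proof.
apply: sum_linear_combination; last exact: sum_dW2_dev.
exact: sum_sqr_dev sum_barycenter_mean.
Qed.

End Barycenter.

(** * The decompositions *)

Section Decomposition.
Context {R : realType} {n p K : nat}.
Variables (y : 'I_n -> 'I_p -> histogram R) (C : 'I_K -> {set 'I_n}).
Variables (g : 'I_K -> 'I_p -> histogram R) (gE : 'I_p -> histogram R).

Lemma CDC_decomposition (lmean ldisp : 'I_K -> 'I_p -> R) :
  (forall k j, is_barycenter (C k) (fun i => y i j) (g k j)) ->
  TSS_CDC y C lmean ldisp gE =
  WSS_CDC y C g lmean ldisp + BSS_CDC C g lmean ldisp gE.
Proof.
move=> bg; rewrite /TSS_CDC /WSS_CDC /BSS_CDC.
under [in RHS]eq_bigr do rewrite exchange_big/=.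
rewrite [in RHS]exchange_big/= -big_split/=; apply: eq_bigr => j _.
rewrite -big_split/=; apply: eq_bigr => k _.
exact: (sum_adaptive_dev (bg k j)).
Qed.

Lemma sum_clustering (F : 'I_n -> R) : clustering C ->
  \sum_i F i = \sum_k \sum_(i in C k) F i.
Proof.
move=> [Cinj partC].
transitivity (\sum_(i in [set: 'I_n]%SET) F i).
  by apply: eq_bigl => i; rewrite !inE.
by rewrite (set_partition_big _ partC)/= big_imset//= => k l _ _; exact: Cinj.
Qed.

Lemma TSS_GC_CDC (lmean ldisp : 'I_p -> R) : clustering C ->
  TSS_GC y lmean ldisp gE =
  TSS_CDC y C (fun=> lmean) (fun=> ldisp) gE.
Proof. by move=> clC; apply: eq_bigr => j _; exact: sum_clustering. Qed.

End Decomposition.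

Theorem mainTheorem5 (R : realType) (n p K : nat)
    (y : 'I_n -> 'I_p -> histogram R)
    (C : 'I_K -> {set 'I_n}) (g : 'I_K -> 'I_p -> histogram R)
    (hC : clustering C)
    (hg : forall k j, is_barycenter (C k) (fun i => y i j) (g k j)) :
  (forall (lmean ldisp : 'I_p -> R) (gE : 'I_p -> histogram R),
      product_one_weights lmean -> product_one_weights ldisp ->
      GC_prototype y gE ->
      TSS_GC y lmean ldisp gE =
        WSS_GC y C g lmean ldisp + BSS_GC C g lmean ldisp gE) /\
  (forall (lmean ldisp : 'I_K -> 'I_p -> R) (gE : 'I_p -> histogram R),
      (forall k, product_one_weights (lmean k)) ->
      (forall k, product_one_weights (ldisp k)) ->
      CDC_prototype y C lmean ldisp gE ->
      TSS_CDC y C lmean ldisp gE =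
        WSS_CDC y C g lmean ldisp + BSS_CDC C g lmean ldisp gE).
Proof.
split=> lmean ldisp gE _ _ _; last exact: CDC_decomposition.
by rewrite (TSS_GC_CDC _ _ _ _ _ hC); exact: CDC_decomposition.
Qed.
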